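(* Let $m$ be a positive integer, let $\mu\in\mathbb{C}$ with $\mu\neq 0$ and $|\mu|\leq 1$, and let $\Phi(z)=\mu z$ for $z\in\mathbb{C}$. Then $C_\Phi$ is an $m$-isometry on $H_E(\xi)$ if and only if $C_\Phi$ is an isometry.
   Context: Let $\xi=(\xi_n)_{n\ge 0}$ be a sequence of positive real numbers with $\lim_{n\to\infty}\xi_n^{1/n}=\infty$. $H_E(\xi)$ is the Hilbert space of entire functions $f(z)=\sum_{n=0}^\infty a_n z^n$ with $\|f\|^2=\sum_{n=0}^\infty |a_n|^2\xi_n^2<\infty$, with inner product $\langle f,g\rangle=\sum_{n=0}^\infty b_n\overline{c_n}\,\xi_n^2$ for $f=\sum b_nz^n$, $g=\sum c_nz^n$. For an entire function $\Phi$, the composition operator is $C_\Phi f=f\circ\Phi$; for $\Phi(z)=\mu z$ with $|\mu|\le 1$ it is bounded on $H_E(\xi)$. A bounded operator $S$ is an isometry if $\|Sx\|=\|x\|$ for all $x$ (equivalently $S^*S=I$). For a positive integer $m$, $S$ is an $m$-isometry if $\sum_{k=0}^m(-1)^{m-k}\binom{m}{k}{S^*}^kS^k=0$. *)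

(* Defs.v *)
(* Stdlib reals with Coquelicot; C is Coquelicot's type of complex numbers. *)
From Stdlib Require Import Reals Lra ClassicalEpsilon.
From Coquelicot Require Import Coquelicot.

(* [f] is entire, with Taylor expansion f(z) = sum_n a_n z^n on all of C. *)
Definition expansion (f : C -> C) (a : nat -> C) : Prop :=
  forall z : C, @is_pseries C_AbsRing C_NormedModule a z (f z).

(* The Taylor coefficients of an entire function; [coef_unique] below shows
   that the choice is forced. Unspecified when [f] is not entire. *)
Definition coef (f : C -> C) : nat -> C :=
  epsilon (inhabits (fun _ : nat => RtoC 0)) (expansion f).

Definition HE (xi : nat -> R) (f : C -> C) : Prop :=
  (exists a : nat -> C, expansion f a) /\
  ex_series (fun n => (Cmod (coef f n) ^ 2 * xi n ^ 2)%R).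

Definition HEnorm (xi : nat -> R) (f : C -> C) : R :=
  sqrt (Series (fun n => (Cmod (coef f n) ^ 2 * xi n ^ 2)%R)).

(* Coquelicot's [Series] is real-valued, so complex sums are taken
   componentwise. *)
Definition CSeries (u : nat -> C) : C :=
  (Series (fun n => Re (u n)), Series (fun n => Im (u n))).

Definition HEinner (xi : nat -> R) (f g : C -> C) : C :=
  CSeries (fun n => (coef f n * Cconj (coef g n) * RtoC (xi n ^ 2))%C).

(* Operators on H_E(xi) are maps on functions C -> C of which only the
   restriction to [HE xi] matters. *)
Definition bounded_operator (xi : nat -> R) (S : (C -> C) -> C -> C) : Prop :=
  (forall f, HE xi f -> HE xi (S f)) /\
  (forall (c : C) f g, HE xi f -> HE xi g -> forall z,
     S (fun w => c * f w + g w)%C z = (c * S f z + S g z)%C) /\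
  (exists M : R, forall f, HE xi f -> (HEnorm xi (S f) <= M * HEnorm xi f)%R).

Definition is_adjoint (xi : nat -> R) (S T : (C -> C) -> C -> C) : Prop :=
  bounded_operator xi T /\
  forall f g, HE xi f -> HE xi g -> HEinner xi (S f) g = HEinner xi f (T g).

Definition isometry (xi : nat -> R) (S : (C -> C) -> C -> C) : Prop :=
  bounded_operator xi S /\
  forall f, HE xi f -> HEnorm xi (S f) = HEnorm xi f.

(* [T] is the Hilbert space adjoint of [S]; its restriction to [HE xi] is
   unique. [Binomial.C] is the binomial coefficient. *)
Definition m_isometry (xi : nat -> R) (m : nat) (S : (C -> C) -> C -> C)
    : Prop :=
  bounded_operator xi S /\
  exists T, is_adjoint xi S T /\
    forall f, HE xi f -> forall z,
      sum_n (fun k => (RtoC ((-1) ^ (m - k) * Binomial.C m k)%R *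
               Nat.iter k T (Nat.iter k S f) z)%C) m = RtoC 0.

Definition composition_operator (Phi : C -> C) (f : C -> C) : C -> C :=
  fun z => f (Phi z).

Lemma is_series_Re_Im (u : nat -> C) (l : C) :
  @is_series C_AbsRing C_NormedModule u l ->
  is_series (fun n => Re (u n)) (Re l) /\ is_series (fun n => Im (u n)) (Im l).
Proof.
intros H.
assert (E : forall n, @sum_n C_AbelianMonoid u n
  = (sum_n (fun k => Re (u k)) n, sum_n (fun k => Im (u k)) n)).
{ induction n as [|n IH].
  - rewrite !sum_O. destruct (u O); reflexivity.
  - rewrite !sum_Sn, IH. reflexivity. }
split; intros P [e HP];
  assert (HL : @locally C_UniformSpace l (ball l e)) by (exists e; auto);
  destruct (H _ HL) as [N HN]; exists N; intros n Hn; apply HP;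
  specialize (HN n Hn); change (ball l e (@sum_n C_AbelianMonoid u n)) in HN;
  rewrite E in HN; apply HN.
Qed.

Lemma expansion_real (f : C -> C) (a : nat -> C) :
  expansion f a -> forall x : R,
  is_pseries (fun n => Re (a n)) x (Re (f (RtoC x))) /\
  is_pseries (fun n => Im (a n)) x (Im (f (RtoC x))).
Proof.
intros H x.
assert (Hp : forall n, @pow_n C_AbsRing (RtoC x) n
                       = RtoC (@pow_n R_AbsRing x n)).
{ induction n as [|n IH]; [reflexivity|].
  simpl pow_n; rewrite IH. symmetry. apply RtoC_mult. }
destruct (is_series_Re_Im _ _ (H (RtoC x))) as [H1 H2].
split; [revert H1 | revert H2]; apply is_series_ext; intros n;
  rewrite Hp; destruct (a n) as [p q];
  unfold scal, mult; simpl; unfold mult; simpl; ring.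
Qed.

Lemma CV_radius_entire (b : nat -> R) :
  (forall x : R, ex_pseries b x) -> Rbar_lt 0 (CV_radius b).
Proof.
intros H.
destruct (Rbar_lt_le_dec 0 (CV_radius b)) as [h|h]; [exact h|exfalso].
apply (CV_disk_outside b 1).
- rewrite Rabs_R1. apply (Rbar_le_lt_trans _ _ _ h). simpl; lra.
- apply ex_series_lim_0.
  apply (ex_series_ext (fun n => scal (pow_n 1 n) (b n))); [|exact (H 1)].
  intros n. rewrite pow_n_pow. unfold scal; simpl; unfold mult; simpl; ring.
Qed.

Lemma expansion_unique (f : C -> C) (a b : nat -> C) :
  expansion f a -> expansion f b -> forall n, a n = b n.
Proof.
intros Ha Hb n.
assert (HR : forall u v : nat -> R, (forall x, exists l : R,
    is_pseries u x l /\ is_pseries v x l) -> u n = v n).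
{ intros u v H. apply PSeries_ext_recip.
  - apply CV_radius_entire; intros x; destruct (H x) as [l [h _]]; exists l; auto.
  - apply CV_radius_entire; intros x; destruct (H x) as [l [_ h]]; exists l; auto.
  - exists (mkposreal 1 Rlt_0_1); intros x _; destruct (H x) as [l [h1 h2]].
    now rewrite (is_pseries_unique _ _ _ h1), (is_pseries_unique _ _ _ h2). }
apply injective_projections.
- apply (HR (fun n => Re (a n)) (fun n => Re (b n))); intros x.
  exists (Re (f (RtoC x))). split; now apply expansion_real.
- apply (HR (fun n => Im (a n)) (fun n => Im (b n))); intros x.
  exists (Im (f (RtoC x))). split; now apply expansion_real.
Qed.

Lemma coef_unique (f : C -> C) (a : nat -> C) :
  expansion f a -> forall n, coef f n = a n.
Proof.
intros Ha. apply (expansion_unique f); [|exact Ha].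
unfold coef. apply epsilon_spec. now exists a.
Qed.

(* Main.v *)
(* In terms of Taylor coefficients, C_Phi multiplies the n-th coefficient by
   mu^n, so its adjoint multiplies it by (conj mu)^n. Evaluating the m-isometry
   identity on f(z) = z gives (|mu|^2 - 1)^m = 0, hence |mu| = 1, and then C_Phi
   preserves the modulus of every coefficient. Conversely, an isometry satisfies
   |mu| = 1 (again by f(z) = z); the adjoint is then composition with
   z |-> conj(mu) z, the inverse of C_Phi, and the m-isometry identity reduces to
   (1 - 1)^m = 0. *)
Require Import Defs.
From Stdlib Require Import Reals.
From Coquelicot Require Import Coquelicot.
From Stdlib Require Import Lra Lia ClassicalEpsilon.

(** * Series with a single nonzero term *)

Lemma is_series_single {K : AbsRing} {V : NormedModule K} (u : nat -> V) (n : nat) :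
  (forall k, k <> n -> u k = zero) -> is_series u (u n).
Proof.
intros H.
assert (H0 : forall N, (N < n)%nat -> sum_n u N = zero).
{ induction N as [|N IH]; intros h.
  - rewrite sum_O. apply H; lia.
  - rewrite sum_Sn, IH, H by lia. apply plus_zero_l. }
assert (Hn : sum_n u n = u n).
{ destruct n as [|n]; [apply sum_O|].
  rewrite sum_Sn, H0 by lia. apply plus_zero_l. }
(* From index [n] on, the partial sums are constantly [u n]. *)
apply (filterlim_ext_loc (fun _ : nat => u n)); [|apply filterlim_const].
exists n. intros N HN. induction HN as [|N HN IH]; [now symmetry|].
rewrite sum_Sn, <- IH, (H (S N)) by lia. symmetry. apply plus_zero_r.
Qed.

Lemma CSeries_single (u : nat -> C) (n : nat) :
  (forall k, k <> n -> u k = RtoC 0) -> CSeries u = u n.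
Proof.
intros H. unfold CSeries.
rewrite (is_series_unique _ _ (is_series_single (fun k => Re (u k)) n
  (fun k h => f_equal Re (H k h)))).
rewrite (is_series_unique _ _ (is_series_single (fun k => Im (u k)) n
  (fun k h => f_equal Im (H k h)))).
now destruct (u n).
Qed.

Lemma CSeries_ext (u v : nat -> C) :
  (forall n, u n = v n) -> CSeries u = CSeries v.
Proof.
intros H. unfold CSeries.
f_equal; apply Series_ext; intros n; now rewrite H.
Qed.

(** * Taylor expansions and monomials *)

Lemma pow_n_Cpow (z : C) (n : nat) : @pow_n C_AbsRing z n = (z ^ n)%C.
Proof.
induction n as [|n IH]; [reflexivity|].
simpl pow_n. rewrite IH. now rewrite Cpow_S.
Qed.

Lemma expansion_ext (f g : C -> C) (a b : nat -> C) :
  (forall z, f z = g z) -> (forall n, a n = b n) -> expansion f a -> expansion g b.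
Proof.
intros Hf Ha H z. rewrite <- Hf.
apply (is_series_ext (fun k => scal (@pow_n C_AbsRing z k) (a k))); [|apply H].
intros n. now rewrite Ha.
Qed.

Lemma expansion_coef (f : C -> C) :
  (exists a, expansion f a) -> expansion f (coef f).
Proof. apply epsilon_spec. Qed.

Lemma expansion_scale (nu : C) (f : C -> C) (a : nat -> C) :
  expansion f a -> expansion (fun z => f (nu * z)%C) (fun n => nu ^ n * a n)%C.
Proof.
intros H z. generalize (H (nu * z)%C). apply is_series_ext. intros n.
rewrite !pow_n_Cpow, Cpow_mult_l.
change (nu ^ n * z ^ n * a n = z ^ n * (nu ^ n * a n))%C. ring.
Qed.

(** By uniqueness of limits. This passes from coefficients back to values, since the m-isometry
    identity is stated pointwise. *)
Lemma expansion_single_value (f : C -> C) (a : nat -> C) (n : nat) (z : C) :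
  expansion f a -> (forall k, k <> n -> a k = RtoC 0) -> f z = (z ^ n * a n)%C.
Proof.
intros H Ha.
assert (H1 := H z).
assert (H2 := is_series_single (K := C_AbsRing) (V := C_NormedModule)
  (fun k => scal (@pow_n C_AbsRing z k) (a k)) n
  (fun k h => eq_trans (f_equal (scal _) (Ha k h)) (scal_zero_r _))).
unfold is_pseries in H1.
rewrite <- pow_n_Cpow.
exact (filterlim_locally_unique _ _ _ H1 H2).
Qed.

Definition delta (n k : nat) : C := if Nat.eqb k n then RtoC 1 else RtoC 0.

Lemma delta_eq (n : nat) : delta n n = RtoC 1.
Proof. unfold delta. now rewrite Nat.eqb_refl. Qed.

Lemma delta_neq (n k : nat) : k <> n -> delta n k = RtoC 0.
Proof. intros h. unfold delta. now apply Nat.eqb_neq in h as ->. Qed.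

Definition monomial (n : nat) (z : C) : C := (z ^ n)%C.

Lemma monomial_expansion (n : nat) : expansion (monomial n) (delta n).
Proof.
intros z. unfold monomial.
assert (H := is_series_single (K := C_AbsRing) (V := C_NormedModule)
  (fun k => scal (@pow_n C_AbsRing z k) (delta n k)) n
  (fun k h => eq_trans (f_equal (scal _) (delta_neq n k h)) (scal_zero_r _))).
cbv beta in H. rewrite delta_eq, pow_n_Cpow in H.
replace (z ^ n)%C with (scal (z ^ n)%C (RtoC 1) : C_NormedModule); [exact H|].
apply Cmult_1_r.
Qed.

Lemma coef_monomial (n k : nat) : coef (monomial n) k = delta n k.
Proof. apply coef_unique, monomial_expansion. Qed.

(** Gives both the membership of z^n in [HE xi] and the value of its squared norm. *)
Lemma monomial_weight (xi : nat -> R) (n : nat) :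
  is_series (fun k => (Cmod (coef (monomial n) k) ^ 2 * xi k ^ 2)%R) (xi n ^ 2)%R.
Proof.
replace (xi n ^ 2)%R with (Cmod (coef (monomial n) n) ^ 2 * xi n ^ 2)%R.
- apply (is_series_single (fun k => (Cmod (coef (monomial n) k) ^ 2 * xi k ^ 2)%R)).
  intros k h. rewrite coef_monomial, delta_neq, Cmod_0 by exact h.
  unfold zero; simpl. ring.
- rewrite coef_monomial, delta_eq, Cmod_1. ring.
Qed.

Lemma monomial_HE (xi : nat -> R) (n : nat) : HE xi (monomial n).
Proof.
split; [exists (delta n); apply monomial_expansion|].
eexists. apply monomial_weight.
Qed.

(** * Diagonal operators, their adjoints, and the alternating binomial sum *)

Lemma bounded_iter_HE (xi : nat -> R) (S : (C -> C) -> C -> C) (k : nat)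
  (f : C -> C) : bounded_operator xi S -> HE xi f -> HE xi (Nat.iter k S f).
Proof. intros HS Hf. induction k as [|k IH]; [exact Hf|]. now apply HS. Qed.

Lemma coef_iter_diagonal (xi : nat -> R) (S : (C -> C) -> C -> C) (d : nat -> C) :
  bounded_operator xi S ->
  (forall f, HE xi f -> forall n, coef (S f) n = (d n * coef f n)%C) ->
  forall k f n, HE xi f -> coef (Nat.iter k S f) n = (d n ^ k * coef f n)%C.
Proof.
intros HS Hd k f n Hf. induction k as [|k IH].
- simpl. ring.
- simpl Nat.iter. rewrite Hd by now apply (bounded_iter_HE xi).
  rewrite IH, Cpow_S. ring.
Qed.

(** Test the adjoint identity against z^n: both inner products collapse to their n-th term, and the
    weight [xi n ^ 2], being positive, cancels. *)
Lemma adjoint_coef (xi : nat -> R) (S T : (C -> C) -> C -> C) (d : nat -> C) :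
  (forall n, (0 < xi n)%R) -> is_adjoint xi S T ->
  (forall f, HE xi f -> forall n, coef (S f) n = (d n * coef f n)%C) ->
  forall f, HE xi f -> forall n, coef (T f) n = (Cconj (d n) * coef f n)%C.
Proof.
intros xi_pos [_ HT] Hd f Hf n.
assert (E := HT _ _ (monomial_HE xi n) Hf). unfold HEinner in E.
rewrite 2!(CSeries_single _ n) in E.
- rewrite Hd, coef_monomial, delta_eq in E by apply monomial_HE.
  assert (Hx : RtoC (xi n ^ 2) <> RtoC 0).
  { intros h. apply RtoC_inj in h. assert (h' := pow_lt _ 2 (xi_pos n)). lra. }
  assert (E' : (d n * Cconj (coef f n) = Cconj (coef (T f) n))%C).
  { rewrite !Cmult_1_r, Cmult_1_l in E.
    apply (f_equal (fun w => w * / RtoC (xi n ^ 2))%C) in E.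
    rewrite <- !Cmult_assoc, !Cinv_r, !Cmult_1_r in E by exact Hx. exact E. }
  apply (f_equal Cconj) in E'.
  rewrite Cmult_conj, !Cconj_conj in E'. now symmetry.
- intros k h. rewrite coef_monomial, delta_neq by exact h. ring.
- intros k h. rewrite Hd, coef_monomial, delta_neq by (exact h || apply monomial_HE).
  ring.
Qed.

(** The binomial theorem for x + (-1), carried over to complex sums. *)
Lemma alternating_binomial (x : R) (m : nat) :
  sum_n (fun k => RtoC ((-1) ^ (m - k) * Binomial.C m k * x ^ k)%R) m
  = RtoC ((x - 1) ^ m).
Proof.
assert (H : forall (u : nat -> R) n,
  sum_n (fun k => RtoC (u k)) n = RtoC (sum_n u n)).
{ intros u n. induction n as [|n IH].
  - now rewrite !sum_O.
  - rewrite !sum_Sn, IH. symmetry. apply RtoC_plus. }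
rewrite H, sum_n_Reals. f_equal.
replace (x - 1)%R with (x + -1)%R by ring. rewrite binomial.
apply sum_eq. intros i _. ring.
Qed.

(** * Composition with z |-> mu z, applied below to both mu and its conjugate *)

Section Scaling.

Variables (xi : nat -> R) (mu : C) (Phi : C -> C).
Hypothesis Phi_def : forall z : C, Phi z = (mu * z)%C.

Lemma expansion_composition (f : C -> C) (a : nat -> C) :
  expansion f a ->
  expansion (composition_operator Phi f) (fun n => mu ^ n * a n)%C.
Proof.
intros H. eapply expansion_ext; [| |apply expansion_scale, H].
- intros z. unfold composition_operator. now rewrite Phi_def.
- reflexivity.
Qed.

Lemma coef_composition (f : C -> C) : HE xi f -> forall n,
  coef (composition_operator Phi f) n = (mu ^ n * coef f n)%C.
Proof.
intros [H _]. apply coef_unique, expansion_composition, expansion_coef, H.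
Qed.

Lemma HEnorm_composition_monomial1 : (forall n, (0 < xi n)%R) ->
  HEnorm xi (composition_operator Phi (monomial 1))
  = (Cmod mu * HEnorm xi (monomial 1))%R.
Proof.
intros xi_pos. unfold HEnorm.
rewrite (is_series_unique _ _ (monomial_weight xi 1)).
(* Only the term n = 1 is nonzero, so the factor |mu^n|^2 may be replaced by |mu|^2 throughout. *)
rewrite (Series_ext _ (fun n => (Cmod mu ^ 2 *
  (Cmod (coef (monomial 1) n) ^ 2 * xi n ^ 2))%R)).
- rewrite Series_scal_l, (is_series_unique _ _ (monomial_weight xi 1)).
  rewrite sqrt_mult_alt by apply pow2_ge_0.
  now rewrite (sqrt_pow2 (Cmod mu)) by apply Cmod_ge_0.
- intros n. rewrite coef_composition by apply monomial_HE.
  rewrite coef_monomial. destruct (Nat.eq_dec n 1) as [->|h].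
  + rewrite Cmod_mult, Cpow_1_r. ring.
  + rewrite delta_neq, Cmult_0_r, Cmod_0 by exact h. ring.
Qed.

Lemma composition_unimodular_HE (f : C -> C) : Cmod mu = 1%R -> HE xi f ->
  HE xi (composition_operator Phi f) /\
  HEnorm xi (composition_operator Phi f) = HEnorm xi f.
Proof.
intros Hmu Hf.
assert (E : forall n, (Cmod (coef f n) ^ 2 * xi n ^ 2)%R
  = (Cmod (coef (composition_operator Phi f) n) ^ 2 * xi n ^ 2)%R).
{ intros n. rewrite coef_composition by exact Hf.
  now rewrite Cmod_mult, Cmod_pow, Hmu, pow1, Rmult_1_l. }
split; [split|].
- eexists. apply expansion_composition, expansion_coef, Hf.
- exact (ex_series_ext _ _ E (proj2 Hf)).
- unfold HEnorm. now rewrite (Series_ext _ _ E).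
Qed.

Lemma composition_unimodular_isometry : Cmod mu = 1%R ->
  isometry xi (composition_operator Phi).
Proof.
intros Hmu. split; [split; [|split]|].
- intros f Hf. now apply composition_unimodular_HE.
(* Linearity holds by computation: precomposition acts pointwise. *)
- reflexivity.
- exists 1%R. intros f Hf.
  rewrite (proj2 (composition_unimodular_HE f Hmu Hf)). lra.
- intros f Hf. now apply composition_unimodular_HE.
Qed.

Lemma isometry_unimodular : (forall n, (0 < xi n)%R) ->
  isometry xi (composition_operator Phi) -> Cmod mu = 1%R.
Proof.
intros xi_pos [_ H].
assert (E := H _ (monomial_HE xi 1)).
rewrite HEnorm_composition_monomial1 in E by exact xi_pos.
(* The norm of z is [xi 1], hence nonzero, and cancels from |mu| ||z|| = ||z||. *)
assert (Hn : (0 < HEnorm xi (monomial 1))%R).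
{ unfold HEnorm. rewrite (is_series_unique _ _ (monomial_weight xi 1)).
  apply sqrt_lt_R0, pow_lt, xi_pos. }
apply (Rmult_eq_reg_r (HEnorm xi (monomial 1))); lra.
Qed.

Lemma m_isometry_unimodular (m : nat) : (forall n, (0 < xi n)%R) ->
  m_isometry xi m (composition_operator Phi) -> Cmod mu = 1%R.
Proof.
intros xi_pos [HS [T [HT H]]].
assert (HTd := adjoint_coef xi _ T _ xi_pos HT coef_composition).
(* The function z is an eigenvector of T^k S^k with eigenvalue |mu|^(2k); evaluating at the point 1
   reads off the eigenvalue. *)
assert (V : forall k,
  Nat.iter k T (Nat.iter k (composition_operator Phi) (monomial 1)) (RtoC 1)
  = RtoC ((Cmod mu ^ 2) ^ k)).
{ intros k.
  assert (H1 := bounded_iter_HE xi _ k _ HS (monomial_HE xi 1)).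
  assert (H2 := bounded_iter_HE xi _ k _ (proj1 HT) H1).
  assert (Ec : forall n, coef (Nat.iter k T (Nat.iter k (composition_operator Phi)
      (monomial 1))) n = (Cconj (mu ^ n) ^ k * ((mu ^ n) ^ k * delta 1 n))%C).
  { intros n.
    rewrite (coef_iter_diagonal xi T _ (proj1 HT) HTd) by exact H1.
    rewrite (coef_iter_diagonal xi _ _ HS coef_composition) by apply monomial_HE.
    now rewrite coef_monomial. }
  rewrite (expansion_single_value _ _ 1 (RtoC 1) (expansion_coef _ (proj1 H2))).
  - rewrite Ec, delta_eq, !Cpow_1_r, RtoC_pow, Cmod2_conj, Cpow_mult_l. ring.
  - intros n h. rewrite Ec, delta_neq by exact h. ring. }
assert (E := H _ (monomial_HE xi 1) (RtoC 1)).
rewrite (sum_n_ext _ (fun k =>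
  RtoC ((-1) ^ (m - k) * Binomial.C m k * (Cmod mu ^ 2) ^ k)%R)) in E.
2: { intros k. now rewrite V, <- RtoC_mult. }
rewrite alternating_binomial in E. apply RtoC_inj in E.
destruct (Req_dec (Cmod mu ^ 2 - 1) 0) as [h|h].
(* From |mu|^2 = 1 and |mu| >= 0. In the other case a nonzero real would have a vanishing m-th
   power. *)
- assert (h' := Cmod_ge_0 mu). nra.
- now apply (pow_nonzero _ m) in h.
Qed.

End Scaling.

(** * From |mu| = 1 to the m-isometry identity *)

Lemma composition_unimodular_m_isometry (xi : nat -> R) (m : nat) (mu : C)
  (Phi : C -> C) : (0 < m)%nat -> Cmod mu = 1%R ->
  (forall z : C, Phi z = (mu * z)%C) ->
  m_isometry xi m (composition_operator Phi).
Proof.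
intros Hm Hmu Phi_def.
pose (Psi := fun z : C => (Cconj mu * z)%C).
assert (Psi_def : forall z, Psi z = (Cconj mu * z)%C) by reflexivity.
assert (HPsi : Cmod (Cconj mu) = 1%R) by now rewrite Cmod_conj.
assert (Hinv : forall z, Phi (Psi z) = z).
{ intros z. rewrite Phi_def. unfold Psi.
  rewrite Cmult_assoc, <- Cmod2_conj, Hmu, pow1. apply Cmult_1_l. }
split; [now apply (composition_unimodular_isometry xi mu)|].
exists (composition_operator Psi). split; [split|].
- now apply (composition_unimodular_isometry xi (Cconj mu)).
(* The adjoint identity holds term by term: conjugating conj(mu)^n in the second slot returns
   mu^n. *)
- intros f g Hf Hg. apply CSeries_ext. intros n.
  rewrite (coef_composition xi mu Phi Phi_def f Hf).
  rewrite (coef_composition xi (Cconj mu) Psi Psi_def g Hg).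
  rewrite Cmult_conj, Cpow_conj, Cconj_conj. ring.
- intros f _ z.
  assert (V : forall k z, Nat.iter k (composition_operator Psi)
      (Nat.iter k (composition_operator Phi) f) z = f z).
  (* Iterating a composition operator amounts to composing with the iterated symbol, so the claim
     becomes f(Phi^k(Psi^k(z))) = f(z). *)
  { assert (P : forall (F : C -> C) k h z,
        Nat.iter k (composition_operator F) h z = h (Nat.iter k F z)).
    { intros F k h. induction k as [|k IH]; intros w; [reflexivity|].
      change (Nat.iter k (composition_operator F) h (F w)
              = h (Nat.iter (S k) F w)).
      now rewrite IH, Nat.iter_succ_r. }
    intros k w. rewrite !P. f_equal. revert w.
    induction k as [|k IH]; intros w; [reflexivity|].
    (* The innermost [Phi] meets the outermost [Psi] and cancels it. *)
    rewrite Nat.iter_succ_r. change (Nat.iter (S k) Psi w)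
      with (Psi (Nat.iter k Psi w)). now rewrite Hinv. }
  (* The factor 1^k is inserted to match [alternating_binomial] at x = 1; the constant [f z] is then
     pulled out of the sum. *)
  rewrite (sum_n_ext _ (fun k => mult (RtoC ((-1) ^ (m - k) *
    Binomial.C m k * 1 ^ k)%R : C_Ring) (f z))).
  2: { intros k. now rewrite V, pow1, Rmult_1_r. }
  rewrite sum_n_mult_r.
  assert (A := alternating_binomial 1 m).
  (* Here m > 0 gives 0^m = 0, whereas 0^0 = 1. *)
  rewrite Rminus_diag, pow_i in A by exact Hm.
  transitivity (RtoC 0 * f z)%C; [|apply Cmult_0_l].
  exact (f_equal (fun w => w * f z)%C A).
Qed.

Theorem theorem4p1
  (xi : nat -> R)
  (xi_pos : forall n, (0 < xi n)%R)
  (xi_lim : is_lim_seq (fun n => Rpower (xi n) (/ INR n)) p_infty)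
  (m : nat) (m_pos : (0 < m)%nat)
  (mu : C) (mu_neq0 : mu <> RtoC 0) (mu_le1 : (Cmod mu <= 1)%R)
  (Phi : C -> C) (Phi_def : forall z : C, Phi z = (mu * z)%C) :
  m_isometry xi m (composition_operator Phi)
  <-> isometry xi (composition_operator Phi).
Proof.
split; intros H.
- apply (composition_unimodular_isometry xi mu); [exact Phi_def|].
  now apply (m_isometry_unimodular xi mu Phi Phi_def m).
- apply (composition_unimodular_m_isometry xi m mu); [exact m_pos| |exact Phi_def].
  now apply (isometry_unimodular xi mu Phi).
Qed.
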